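(* Let $g>0$, let $\{V_n\}_{n\in\mathbb{Z}}$ be independent, identically distributed real random variables with common law a probability measure $\mu$ having compact support $M\subseteq\mathbb{R}$, and let $H$ be the (random) bounded operator on $l^2(\mathbb{Z})$ defined by \[ (Hf)_n=e^{-g}f_{n-1}+e^{g}f_{n+1}+V_nf_n . \] Let $E=\{e^{g+i\theta}+e^{-g-i\theta}:\theta\in[0,2\pi]\}$. With probability one, the spectrum of $H$ contains the set $E+m$ for every $m\in M$.
   Context: For $E\subseteq\mathbb{C}$ and $m\in\mathbb{C}$, $E+m=\{z+m:z\in E\}$. *)

(* Defs.v *)
From HB Require Import structures.
From mathcomp Require Import all_boot all_order all_algebra.
From mathcomp Require Import finmap complex.
From mathcomp Require Import all_classical all_reals all_analysis.
From mathcomp Require Import ring lra.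

Set Implicit Arguments.
Unset Strict Implicit.
Unset Printing Implicit Defensive.

Import Order.TTheory GRing.Theory Num.Theory.
Import numFieldNormedType.Exports.
Import ComplexField.Normc.

Local Open Scope classical_set_scope.
Local Open Scope complex_scope.
Local Open Scope ring_scope.

Section l2_energy.
Context {R : realType}.
Implicit Types (u v : int -> R[i]) (n : int).

Definition l2_energy u : \bar R := (\esum_(n in [set: int]) (normc (u n) ^+ 2)%:E)%E.

Lemma l2_energy_ge0 u : (0 <= l2_energy u)%E.
Proof. by apply: esum_ge0 => n _; rewrite lee_fin sqr_ge0. Qed.

Lemma l2_energy0 : l2_energy (0 : int -> R[i]) = 0%E.
Proof. by apply: esum1 => n _; rewrite [(0 : _ -> _) _]/(0 : R[i]) normc0 expr0n. Qed.

Lemma l2_energy_ler u n : ((normc (u n) ^+ 2)%:E <= l2_energy u)%E.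
Proof.
apply: esum_ge; exists [set n]; first by split; [exact: finite_set1|].
by rewrite fsbig_set1.
Qed.

Lemma esum_scale_le (c : R) (a : int -> R) : 0 <= c -> (forall n, 0 <= a n) ->
  (\esum_(n in [set: int]) (c * a n)%:E <= c%:E * \esum_(n in [set: int]) (a n)%:E)%E.
Proof.
move=> c0 a0; apply: ge_ereal_sup => _ [X [finX _]] <-.
rewrite (eq_fsbigr (fun n => (c%:E * (a n)%:E)%E)); last by move=> n _; rewrite EFinM.
rewrite -ge0_mule_fsumr; last by move=> n; rewrite lee_fin.
rewrite lee_wpmul2l ?lee_fin//.
by apply: esum_ge; exists X.
Qed.

Lemma l2_energyZ_le (c : R[i]) u :
  (l2_energy (c *: u) <= (normc c ^+ 2)%:E * l2_energy u)%E.
Proof.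
apply: le_trans (esum_scale_le _ _); [|by rewrite sqr_ge0|by move=> n; rewrite sqr_ge0].
by apply: le_esum => n _; rewrite lee_fin [(c *: u) n]/(c * u n) normcM exprMn.
Qed.

Lemma normcDsqr_le (t : R) (a b : R[i]) : 0 < t ->
  normc (a + b) ^+ 2 <= (1 + t) * normc a ^+ 2 + (1 + t^-1) * normc b ^+ 2.
Proof.
move=> t0.
have normc_ge0 (z : R[i]) : 0 <= normc z by case: z => x y; exact: sqrtr_ge0.
have ab : normc (a + b) ^+ 2 <= (normc a + normc b) ^+ 2.
  by rewrite lerXn2r ?nnegrE ?addr_ge0//; exact: le_normcD.
apply: le_trans ab _; rewrite -subr_ge0.
set x := normc a; set y := normc b.
rewrite (_ : _ - _ = t^-1 * (t * x - y) ^+ 2); last by field; rewrite gt_eqF.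
by rewrite mulr_ge0 ?sqr_ge0// invr_ge0 ltW.
Qed.

Lemma l2_energyD_le (t : R) u v : 0 < t ->
  (l2_energy (u + v)%R <= (1 + t)%:E * l2_energy u + (1 + t^-1)%:E * l2_energy v)%E.
Proof.
move=> t0.
have t1 : 0 <= 1 + t by rewrite addr_ge0// ltW.
have t2 : 0 <= 1 + t^-1 by rewrite addr_ge0// invr_ge0 ltW.
apply: (@le_trans _ _ (\esum_(n in [set: int]) ((1 + t) * normc (u n) ^+ 2)%:E +
   \esum_(n in [set: int]) ((1 + t^-1) * normc (v n) ^+ 2)%:E)%E).
  rewrite -esumD; [|by move=> n _; rewrite lee_fin mulr_ge0 ?sqr_ge0..].
  apply: le_esum => n _; rewrite -EFinD lee_fin.
  exact: normcDsqr_le.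
by apply: leeD; apply: esum_scale_le => // n; rewrite sqr_ge0.
Qed.

Definition l2_pred : {pred int -> R[i]} := fun u => (l2_energy u < +oo)%E.

Lemma l2_submod_closed : submod_closed l2_pred.
Proof.
split; first by rewrite unfold_in l2_energy0 ltry.
move=> c u v; rewrite !unfold_in => fu fv.
have fcu : (l2_energy (c *: u) < +oo)%E.
  apply: le_lt_trans (l2_energyZ_le _ _) _.
  by apply: lte_mul_pinfty; rewrite ?lee_fin ?sqr_ge0.
apply: le_lt_trans (l2_energyD_le _ _ (ltr01 : 0 < 1)) _.
by apply: lte_add_pinfty; apply: lte_mul_pinfty; rewrite ?lee_fin// addr_ge0 ?invr_ge0 ?ler01.
Qed.
HB.instance Definition _ := GRing.isSubmodClosed.Build R[i] (int -> R[i]) l2_pred l2_submod_closed.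

End l2_energy.

Record l2 (R : realType) := L2 {
  l2_fun :> int -> R[i];
  l2_funP : l2_fun \in l2_pred }.

HB.instance Definition _ (R : realType) := [isSub for @l2_fun R].
HB.instance Definition _ (R : realType) := [Choice of l2 R by <:].
HB.instance Definition _ (R : realType) := [SubChoice_isSubLmodule of l2 R by <:].

Section l2_norm.
Context {R : realType}.
Implicit Types (u v : l2 R).

Definition l2_normr u : R := Num.sqrt (fine (l2_energy u)).

(* The norm of a normed module over [R[i]] takes its values in [R[i]]. *)
Definition l2_norm u : R[i] := (l2_normr u)%:C.

Let fin u : l2_energy u \is a fin_num.
Proof. by rewrite ge0_fin_numE ?l2_energy_ge0//; exact: l2_funP. Qed.

Let nrg u := fine (l2_energy u).
Let nrg_ge0 u : 0 <= nrg u. Proof. by rewrite fine_ge0// l2_energy_ge0. Qed.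

Let nrgD t u v : 0 < t -> nrg (u + v) <= (1 + t) * nrg u + (1 + t^-1) * nrg v.
Proof.
move=> t0; rewrite -lee_fin EFinD !EFinM !fineK//.
exact: (l2_energyD_le (l2_fun u) (l2_fun v) t0).
Qed.

Let nrgZ_le c u : nrg (c *: u) <= normc c ^+ 2 * nrg u.
Proof. rewrite -lee_fin EFinM !fineK//; exact: (l2_energyZ_le c (l2_fun u)). Qed.

Let nrg_eq0 u : nrg u = 0 -> u = 0.
Proof.
move=> u0; apply/val_inj/funext => n /=; apply: eq0_normc.
have := l2_energy_ler u n; rewrite -(fineK (fin u)) lee_fin -/(nrg u) u0 => h.
by apply/eqP; rewrite -sqrf_eq0 eq_le h sqr_ge0.
Qed.

Let normrD u v : l2_normr (u + v) <= l2_normr u + l2_normr v.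
Proof.
have [u0|u0] := eqVneq (nrg u) 0.
  by rewrite (nrg_eq0 u0) add0r lerDr sqrtr_ge0.
have [v0|v0] := eqVneq (nrg v) 0.
  by rewrite (nrg_eq0 v0) addr0 lerDl sqrtr_ge0.
have x0 : 0 < l2_normr u by rewrite sqrtr_gt0 lt_neqAle eq_sym u0 nrg_ge0.
have y0 : 0 < l2_normr v by rewrite sqrtr_gt0 lt_neqAle eq_sym v0 nrg_ge0.
have := nrgD u v (divr_gt0 y0 x0).
rewrite -[nrg u]sqr_sqrtr// -[nrg v]sqr_sqrtr// -/(l2_normr u) -/(l2_normr v).
rewrite (_ : _ + _ = (l2_normr u + l2_normr v) ^+ 2); last first.
  by field; rewrite !gt_eqF.
move=> h; rewrite -(@ler_pXn2r _ 2)// ?nnegrE ?addr_ge0 ?sqrtr_ge0//.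
by have -> : l2_normr (u + v) ^+ 2 = nrg (u + v) by rewrite sqr_sqrtr ?nrg_ge0.
Qed.

Let normrZ c u : l2_normr (c *: u) = normc c * l2_normr u.
Proof.
have normc_ge0 (z : R[i]) : 0 <= normc z by case: z => x y; exact: sqrtr_ge0.
have le_ c' w : l2_normr (c' *: w) <= normc c' * l2_normr w.
  rewrite -[normc c']ger0_norm// -sqrtr_sqr -sqrtrM ?sqr_ge0//.
  by rewrite ler_wsqrtr//; exact: nrgZ_le.
apply/eqP; rewrite eq_le le_/=.
have [->|c0] := eqVneq c 0; first by rewrite normc0 mul0r sqrtr_ge0.
have := le_ c^-1 (c *: u); rewrite scalerA mulVf// scale1r normcV.
rewrite mulrC ler_pdivlMr 1?mulrC// lt_neqAle normc_ge0 andbT eq_sym.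
by apply: contra c0 => /eqP/eq0_normc ->.
Qed.

Let l2_normD u v : l2_norm (u + v) <= l2_norm u + l2_norm v.
Proof. by rewrite /l2_norm -raddfD/= lecR. Qed.

Let l2_normZ c u : l2_norm (c *: u) = `|c| * l2_norm u.
Proof. by rewrite /l2_norm normrZ rmorphM. Qed.

Let l2_norm_eq0 u : l2_norm u = 0 -> u = 0.
Proof.
move=> /(congr1 (@complex.Re R))/= /eqP; rewrite sqrtr_eq0 => h.
by apply/nrg_eq0/eqP; rewrite eq_le h nrg_ge0.
Qed.

HB.instance Definition _ :=
  Lmodule_isNormed.Build R[i] (l2 R) l2_normD l2_normZ l2_norm_eq0.

End l2_norm.

Section spectrum.
Context {K : numFieldType} {V : normedModType K}.

(* For linear maps, [bounded_near _ (nbhs 0)] is boundedness in operator norm,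
   see [linear_boundedP]. *)
Definition bounded_operator (T : {linear V -> V}) := bounded_near T (nbhs 0).

Definition resolvent_set (T : {linear V -> V}) : set K :=
  [set z | exists S : {linear V -> V}, [/\ bounded_operator S,
     forall x, S (T x - z *: x) = x & forall x, T (S x) - z *: S x = x]].

Definition spectrum (T : {linear V -> V}) : set K := ~` resolvent_set T.

End spectrum.

Section probability.
Context d (Omega : measurableType d) (R : realType) (P : probability Omega R).

Definition mutually_independent d' (T : measurableType d') (I : choiceType)
    (X : I -> {RV P >-> T}) :=
  forall (J : {fset I}) (A : I -> set T), (forall i, measurable (A i)) ->
    P (\bigcap_(i in [set` J]) (X i @^-1` A i)) =
    (\prod_(i <- J) P (X i @^-1` A i))%E.

End probability.

Definition measure_support {R : realType} (mu : set R -> \bar R) : set R :=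
  [set x | forall U : set R, open U -> U x -> (0 < mu U)%E].

Definition cexp {R : realType} (z : R[i]) : R[i] :=
  (expR (complex.Re z))%:C * (cos (complex.Im z) +i* sin (complex.Im z)).

Definition translate {R : realType} (E : set R[i]) (m : R[i]) : set R[i] :=
  [set z + m | z in E].

Section hatano_nelson.
Context {R : realType}.

(* Defined on all sequences: for an unbounded potential it does not preserve
   [l2], so that it is a bounded operator only for bounded [V]. *)
Definition hatano_nelson (g : R) (V : int -> R) (f : int -> R[i]) (n : int) : R[i] :=
  (expR (- g))%:C * f (n - 1) + (expR g)%:C * f (n + 1) + (V n)%:C * f n.

Definition hn_ellipse (g : R) : set R[i] :=
  [set cexp (g +i* theta) + cexp (- (g +i* theta)) | theta in `[0, 2 * pi]].

End hatano_nelson.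

(* Main.v *)
Require Import Defs.
From HB Require Import structures.
From mathcomp Require Import all_boot all_order all_algebra.
From mathcomp Require Import finmap complex.
From mathcomp Require Import all_classical all_reals all_analysis.
From mathcomp Require Import ring lra zify.
Import Order.TTheory GRing.Theory Num.Theory.
Import numFieldNormedType.Exports.
Import ComplexField.Normc.
Local Open Scope classical_set_scope.
Local Open Scope complex_scope.
Local Open Scope ring_scope.

Set Implicit Arguments.
Unset Strict Implicit.
Unset Printing Implicit Defensive.

(** Almost surely the potential takes all its values in the compact support of
    its law and looks, somewhere on the line, almost constant equal to any given
    point [m] of the support on a stretch of any given length.  On such a stretch
    the operator acts like the deterministic one with constant potential [m], for
    which the plane wave [n |-> u ^ n] with [|u| = 1] is a bounded eigenfunction
    of eigenvalue [z = e^g u + e^(-g) u^-1 + m]; when [u = e^(i theta)] runs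
    through the unit circle, [z] runs through the translated ellipse.

    Cutting the plane wave off outside a window of length [L] gives a vector of
    squared norm [L].  The two ends of the window contribute to [(H - z) f] a
    squared norm bounded independently of [L], and the oscillation of the
    potential in the window contributes at most a multiple of [eps ^ 2 * L]
    ([cut_wave_defect]).  For [eps] small and [L] large the cut-off waves are
    therefore approximate eigenvectors, so [H - z] has no bounded inverse
    ([spectrum_of_constant_windows]): a bounded left inverse would force [H - z]
    to be bounded below ([spectrum_approx_eigenvectors]).

    The existence of the windows ([ae_constant_windows]) has to hold with
    probability one simultaneously for all [m], [eps] and [L].  Intervals with
    rational endpoints reduce this to countably many almost sure events.  For one
    such interval of positive mass [p], the line is split into blocks of length
    [L]; the blocks are independent and each of them is entirely inside the
    interval with probability [p ^ L], so all of them fail with probability zero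
    ([ae_hit]).  Rational intervals of mass zero give in the same way that the
    potential stays in the support ([ae_in_support]), hence is bounded, so that
    the formula for [H] defines a bounded operator on [l2]
    ([hatano_nelson_bounded_operator]). *)

(** * Energy estimates for sequences *)
Section sequences.
Context {R : realType}.
Implicit Types (u v : int -> R[i]) (A B : {fset int}).

Lemma normc_real (x : R) : normc x%:C = `|x|.
Proof. by rewrite /normc /= expr0n addr0 sqrtr_sqr. Qed.

Lemma normc_ge0 (z : R[i]) : 0 <= normc z.
Proof. by case: z => x y; exact: sqrtr_ge0. Qed.

Lemma l2_energy_shift u k : l2_energy (fun n => u (n + k)) = l2_energy u.
Proof.
rewrite /l2_energy; apply/esym.
apply: (@reindex_esum R int int setT setT (fun n => n + k)
  (fun n => (normc (u n) ^+ 2)%:E)); split => //.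
- by move=> x y _ _ /addIr.
- by move=> n _; exists (n - k) => //; rewrite subrK.
Qed.

Lemma l2_energy_mul_le (V : int -> R) (b : R) u : (forall n, `|V n| <= b) ->
  (l2_energy (fun n => (V n)%:C * u n)%R <= (b ^+ 2)%:E * l2_energy u)%E.
Proof.
move=> Vb; apply: le_trans (esum_scale_le _ _); last 2 first.
- exact: sqr_ge0.
- by move=> n; exact: sqr_ge0.
apply: le_esum => n _; rewrite lee_fin normcM exprMn normc_real.
by rewrite ler_wpM2r ?sqr_ge0// lerXn2r ?nnegrE// (le_trans _ (Vb n)).
Qed.

(** The operator is a combination of two shifts, which preserve the energy, and
    of a bounded multiplication. *)
Lemma hatano_nelson_energy_le g (V : int -> R) (b : R) :
  (forall n, `|V n| <= b) ->
  exists2 K : R, 0 <= K & forall u,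
    (l2_energy (hatano_nelson g V u) <= K%:E * l2_energy u)%E.
Proof.
move=> Vb.
pose K1 := normc (expR (- g))%:C ^+ 2; pose K2 := normc (expR g)%:C ^+ 2.
pose K := (1 + 1) * ((1 + 1) * K1 + (1 + 1^-1) * K2) + (1 + 1^-1) * b ^+ 2 : R.
have K10 : 0 <= K1 by exact: sqr_ge0.
have K20 : 0 <= K2 by exact: sqr_ge0.
have b20 : 0 <= b ^+ 2 by exact: sqr_ge0.
have two0 : 0 <= (1 + 1^-1) :> R by rewrite invr1 addr_ge0.
have two1 : 0 <= (1 + 1) :> R by rewrite addr_ge0.
have c1 : 0 <= (1 + 1) * K1 by rewrite mulr_ge0.
have c2 : 0 <= (1 + 1^-1) * K2 by rewrite mulr_ge0.
have c12 : 0 <= (1 + 1) * ((1 + 1) * K1 + (1 + 1^-1) * K2).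
  by rewrite mulr_ge0// addr_ge0.
have cb : 0 <= (1 + 1^-1) * b ^+ 2 by rewrite mulr_ge0.
exists K; [exact: addr_ge0 | move=> u].
have -> : hatano_nelson g V u =
    ((expR (- g))%:C *: (fun n => u (n - 1)) : int -> R[i]) +
    ((expR g)%:C *: (fun n => u (n + 1)) : int -> R[i]) +
    (fun n => (V n)%:C * u n) by exact/funext.
apply: le_trans (l2_energyD_le _ _ ltr01) _.
rewrite /K [in leRHS]EFinD ge0_muleDl ?lee_fin//.
rewrite leeD//.
- rewrite [in leRHS]EFinM -muleA lee_wpmul2l ?lee_fin ?addr_ge0//.
  apply: le_trans (l2_energyD_le _ _ ltr01) _.
  rewrite [in leRHS]EFinD ge0_muleDl ?lee_fin//.
  rewrite [in leRHS]EFinM [in X in (_ <= _ + X)%E]EFinM -!muleA leeD//; rewrite lee_wpmul2l ?lee_fin ?addr_ge0//.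
  + by apply: le_trans (l2_energyZ_le _ _) _; rewrite (l2_energy_shift u (- 1)).
  + by apply: le_trans (l2_energyZ_le _ _) _; rewrite (l2_energy_shift u 1).
- by rewrite [in leRHS]EFinM -muleA lee_wpmul2l ?lee_fin//; exact: l2_energy_mul_le.
Qed.

Lemma esum_indic_fset A (c : R) : 0 <= c ->
  (\esum_(n in [set: int]) (c * (n \in A)%:R)%:E = (c * #|` A|%:R)%:E)%E.
Proof.
move=> c0.
have -> : (\esum_(n in [set: int]) (c * (n \in A)%:R)%:E =
           \esum_(n in [set` A]) c%:E)%E.
  rewrite [RHS]esum_mkcond; apply: eq_esum => n _.
  by rewrite mem_setE; case: (n \in A); rewrite ?mulr1 ?mulr0.
rewrite esum_fset//.
rewrite fsbig_finite//= set_fsetK sumEFin.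
by rewrite big_seq_fsetE/= sumr_const -cardfE mulr_natr.
Qed.

(** Energies are only ever computed for finitely supported sequences; a pointwise
    bound by two indicators separates the bulk of a window from its ends. *)
Lemma l2_energy_le_indic u A B (a b : R) : 0 <= a -> 0 <= b ->
  (forall n, normc (u n) ^+ 2 <= a * (n \in A)%:R + b * (n \in B)%:R) ->
  (l2_energy u <= (a * #|` A|%:R + b * #|` B|%:R)%:E)%E.
Proof.
move=> a0 b0 ub.
rewrite EFinD -!esum_indic_fset// -esumD; last 2 first.
- by move=> *; rewrite lee_fin mulr_ge0.
- by move=> *; rewrite lee_fin mulr_ge0.
by apply: le_esum => n _; rewrite -EFinD lee_fin.
Qed.

End sequences.

(** * The operator on square-summable sequences *)
Section operators.
Context {R : realType}.
Implicit Types (u v : l2 R).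

Lemma l2_energy_lty u : (l2_energy u < +oo)%E.
Proof. by have := l2_funP u; rewrite unfold_in. Qed.

Lemma l2_energy_fin_num u : l2_energy u \is a fin_num.
Proof. by rewrite ge0_fin_numE ?l2_energy_ge0// l2_energy_lty. Qed.

Lemma l2_norm_le u v (k : R) : 0 <= k ->
  (l2_energy u <= k%:E * l2_energy v)%E ->
  `|u| <= (Num.sqrt k)%:C * `|v|.
Proof.
move=> k0; rewrite -(fineK (l2_energy_fin_num u)) -(fineK (l2_energy_fin_num v)) -EFinM lee_fin => uv.
rewrite -[ `|u|]/((l2_normr u)%:C) -[ `|v|]/((l2_normr v)%:C) -rmorphM/= lecR.
by rewrite -sqrtrM// ler_wsqrtr.
Qed.

Lemma hatano_nelson_bounded_operator g (V : int -> R) (b : R) :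
  (forall n, `|V n| <= b) ->
  exists2 H : {linear l2 R -> l2 R}, bounded_operator H &
    forall (f : l2 R) n, H f n = hatano_nelson g V f n.
Proof.
move=> Vb.
have Hl2 (f : l2 R) : hatano_nelson g V f \in l2_pred.
  have [K K0 HK] := hatano_nelson_energy_le g Vb.
  rewrite unfold_in; apply: le_lt_trans (HK f) _.
  by apply: lte_mul_pinfty; rewrite ?lee_fin// l2_energy_lty.
pose T (f : l2 R) : l2 R := L2 (Hl2 f).
have linT : linear T.
  move=> c f h; apply/val_inj/funext => n.
  have -> : val (T (c *: f + h)) n = hatano_nelson g V (c *: f + h) n by [].
  have -> : val (c *: T f + T h) n =
    c * hatano_nelson g V f n + hatano_nelson g V h n by [].
  rewrite /hatano_nelson.
  have E m : (c *: f + h) m = c * f m + h m by [].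
  rewrite !E; ring.
pose M := GRing.isLinear.Build _ _ _ _ T linT.
pose H : {linear l2 R -> l2 R} := HB.pack T M.
exists H => //; apply/linear_boundedP.
have [K K0 HK] := hatano_nelson_energy_le g Vb.
near=> r => f.
apply: le_trans (l2_norm_le K0 (HK f : (l2_energy (H f) <= _)%E)) _.
rewrite ler_wpM2r//; near: r; apply: nbhs_pinfty_ge.
by rewrite ger0_real// lecR sqrtr_ge0.
Unshelve. all: end_near.
Qed.
End operators.

(** * Cut-off plane waves *)

(** If [S] is a left inverse of [T - z] bounded by [c], then
    [`|x| = `|S (T x - z x)| <= c * `|T x - z x|] for every [x]. *)
Lemma spectrum_approx_eigenvectors (K : numFieldType) (V : normedModType K)
    (T : {linear V -> V}) (z : K) :
  (forall c : K, 0 < c -> exists x, c * `|T x - z *: x| < `|x|) ->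
  spectrum T z.
Proof.
move=> approx [S [/linear_boundedP/pinfty_ex_gt0[c c0 Sc] ST _]].
have [x] := approx c c0; rewrite -[X in _ < `|X|](ST x) => cx.
by have := lt_le_trans cx (Sc _); rewrite ltxx.
Qed.

Definition window (N : int) (L : nat) : {fset int} :=
  [fset (N + (nat_of_ord i)%:Z)%R | i : 'I_L]%fset.

Lemma in_window N L n : (n \in window N L) = (N <= n) && (n < N + L%:Z).
Proof.
apply/imfsetP/idP => /= [[i _ ->]|/andP[Nn nL]].
  by have := ltn_ord i; lia.
have nN : (absz (n - N)%R < L)%N by lia.
by exists (Ordinal nN) => //=; rewrite gez0_abs; lia.
Qed.

Lemma card_window N L : #|` window N L| = L.
Proof.
rewrite card_imfset//=; first by rewrite -cardE card_ord.
by move=> i j /addrI[] /ord_inj.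
Qed.

Section plane_waves.
Context {R : realType}.
Implicit Types (u : R[i]) (N : int) (L : nat).

Lemma normc_expz u n : normc u = 1 -> normc (u ^ n) = 1.
Proof.
move=> u1; have : `|u ^ n| = 1 :> R[i].
  have : `|u| = 1 by rewrite /Num.norm/= u1.
  case: n => n u1'; rewrite ?NegzE -?exprnN ?normfV ?normrX u1' expr1n ?invr1//.
by move=> /(congr1 (@complex.Re R)).
Qed.

Definition cut_wave u N L : int -> R[i] :=
  fun n => u ^ n * (n \in window N L)%:R.

Lemma normc_cut_wave u N L n : normc u = 1 ->
  normc (cut_wave u N L n) = (n \in window N L)%:R.
Proof.
move=> u1; rewrite /cut_wave normcM normc_expz// mul1r.
by case: (n \in _); [exact: normc1 | exact: normc0].
Qed.

Lemma cut_wave_energy u N L : normc u = 1 ->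
  l2_energy (cut_wave u N L) = L%:R%:E.
Proof.
move=> u1; rewrite -[in RHS](card_window N L) -[in RHS](mul1r _%:R) -esum_indic_fset//.
apply: eq_esum => n _; rewrite normc_cut_wave// mul1r.
by case: (n \in _); rewrite ?expr1n ?expr0n.
Qed.

(** The constant potential [m] would give exactly zero inside the window: what
    remains is the error [V n - m] of the potential, and the jumps of the
    indicator of the window, which occur only at the four sites next to its
    ends and have size at most [expR (- g) + expR g] each. *)
Lemma cut_wave_defect g (V : int -> R) m u (eps : R) N L :
  normc u = 1 -> 0 <= eps ->
  (forall n, n \in window N L -> `|V n - m| <= eps) ->
  (l2_energy (fun n => hatano_nelson g V (cut_wave u N L) n -
      ((expR g)%:C * u + (expR (- g))%:C * u^-1 + m%:C) * cut_wave u N L n)%R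
  <= (2 * eps ^+ 2 * L%:R + 8 * (expR (- g) + expR g) ^+ 2)%:E)%E.
Proof.
move=> u1 eps0 Vm; set z := _ + _ + m%:C.
pose C := expR (- g) + expR g.
have C0 : 0 <= C by rewrite addr_ge0// expR_ge0.
(* the sites with a neighbour on the other side of an end of the window *)
pose Bd : {fset int} :=
  ((N - 1)%R |` (N |` ((N + L%:Z - 1)%R |` [fset (N + L%:Z)%R])))%fset.
have cBd : (#|` Bd| <= 4)%N.
  by rewrite !cardfsU1 cardfs1; do 3!case: (_ \notin _).
apply: (@le_trans _ _ (2 * eps ^+ 2 * #|` window N L|%:R
   + 2 * C ^+ 2 * #|` Bd|%:R)%:E); last first.
  rewrite lee_fin card_window lerD2l.
  have : (#|` Bd|%:R <= 4 :> R) by rewrite (ler_nat R _ 4).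
  have : 0 <= C ^+ 2 by exact: sqr_ge0.
  by rewrite -/C; nra.
have u0 : u != 0.
  by apply: contra_eq_neq u1 => ->; rewrite normc0 eq_sym oner_eq0.
apply: l2_energy_le_indic => [||n]; rewrite ?mulr_ge0 ?sqr_ge0//.
set chi := fun n => ((n \in window N L)%:R : R[i]).
(* [u ^ n] is factored out, so that only the jumps of [chi] are left *)
have -> : hatano_nelson g V (cut_wave u N L) n - z * cut_wave u N L n =
  (V n - m)%:C * cut_wave u N L n +
  u ^ n * ((expR (- g))%:C * u^-1 * (chi (n - 1) - chi n) +
           (expR g)%:C * u * (chi (n + 1) - chi n)).
  rewrite /hatano_nelson /z /cut_wave -/(chi _) !expfzDr//.
  rewrite expr1z exprN1 rmorphB/=; ring.
apply: le_trans (normcDsqr_le _ _ ltr01) _.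
rewrite invr1 lerD//.
- rewrite normcM normc_real normc_cut_wave// exprMn -mulrA ler_wpM2l//.
  have [nW|] := boolP (n \in _); last by rewrite expr0n !mulr0.
  by rewrite expr1n !mulr1 lerXn2r ?nnegrE// Vm.
- rewrite normcM normc_expz// mul1r -[leRHS]mulrA ler_wpM2l//.
  have jump k : (k == 1) || (k == -1) ->
      normc (chi (n + k) - chi n) <= (n \in Bd)%:R.
    move=> k1; have [_|] := boolP (n \in Bd).
      rewrite /chi; case: (n + k \in _); case: (n \in _);
        rewrite ?(subrr, subr0, sub0r, normc0, normc1, normcN)//.
    rewrite !inE => nB.
    have -> : chi (n + k) = chi n by rewrite /chi !in_window; congr (_%:R); lia.
    by rewrite subrr normc0.
  have Bd2 : (n \in Bd)%:R = (n \in Bd)%:R ^+ 2 :> R.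
    by case: (n \in Bd); rewrite ?expr1n ?expr0n.
  rewrite Bd2 -exprMn lerXn2r ?nnegrE ?mulr_ge0//; first exact: normc_ge0.
  apply: le_trans (le_normcD _ _) _.
  rewrite /C mulrDl lerD// !normcM ?normcV u1 ?invr1 mulr1 normc_real.
    by rewrite ger0_norm ?expR_ge0// ler_wpM2l ?expR_ge0// jump.
  by rewrite ger0_norm ?expR_ge0// ler_wpM2l ?expR_ge0// jump.
Qed.
End plane_waves.

(** The cut-off wave [f] satisfies [`|(H - z) f| ^ 2 <= k * `|f| ^ 2] where
    [k = 2 * eps ^ 2 + 8 * C / L]: this can be made as small as desired. *)
Lemma spectrum_of_constant_windows (R : realType) g (V : int -> R) m (u : R[i])
    (H : {linear l2 R -> l2 R}) :
  (forall (f : l2 R) n, H f n = hatano_nelson g V f n) ->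
  normc u = 1 ->
  (forall (eps : R) L, 0 < eps ->
     exists N, forall n, n \in window N L -> `|V n - m| <= eps) ->
  spectrum H ((expR g)%:C * u + (expR (- g))%:C * u^-1 + m%:C).
Proof.
move=> HE u1 windows; apply: spectrum_approx_eigenvectors => c c_gt0.
have [c0 c00 ->] : exists2 c0 : R, 0 < c0 & c = c0%:C.
  case: c c_gt0 => a b; rewrite ltcE/= => /andP[/eqP b0 a0].
  by exists a; rewrite // b0.
pose C := (expR (- g) + expR g) ^+ 2.
have C0 : 0 <= C by exact: sqr_ge0.
have B0 : 0 <= 16 * C * c0 ^+ 2 by rewrite mulr_ge0 ?sqr_ge0// mulr_ge0.
(* [eps] and [L] are such that each term of [k] is at most [1 / (2 * c0 ^ 2)],
   the second one strictly: then [c0 * sqrt k < 1] *)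
pose L := Num.bound (16 * C * c0 ^+ 2).
have hL : 16 * C * c0 ^+ 2 < L%:R.
  exact: archi_boundP.
have L0 : 0 < L%:R :> R.
  exact: le_lt_trans hL.
pose eps := (2 * c0)^-1.
have eps0 : 0 < eps by rewrite invr_gt0 mulr_gt0.
have [N VN] := windows eps L eps0.
have wl2 : cut_wave u N L \in l2_pred.
  by rewrite unfold_in cut_wave_energy// ltry.
pose f : l2 R := L2 wl2.
exists f; set z := _ + _ + m%:C.
pose k := 2 * eps ^+ 2 + 8 * C / L%:R.
have k0 : 0 <= k by rewrite addr_ge0 ?divr_ge0// mulr_ge0// sqr_ge0.
have normf : `|f| = (Num.sqrt L%:R)%:C.
  by rewrite -[ `|f|]/((Num.sqrt (fine (l2_energy (cut_wave u N L))))%:C)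
    cut_wave_energy.
have defect : `|H f - z *: f| <= (Num.sqrt k)%:C * `|f|.
  apply: l2_norm_le => //.
  rewrite (_ : l2_energy f = L%:R%:E); last exact: cut_wave_energy.
  rewrite (_ : l2_fun (H f - z *: f) =
    (fun n => hatano_nelson g V (cut_wave u N L) n - z * cut_wave u N L n)).
    have := cut_wave_defect g u1 (ltW eps0) VN; rewrite -/z => /le_trans; apply.
    by rewrite -EFinM lee_fin [leRHS]mulrDl divfK ?gt_eqF.
  by apply/funext => n; rewrite -(HE f).
apply: le_lt_trans (_ : c0%:C * ((Num.sqrt k)%:C * `|f|) < _).
  by rewrite ler_wpM2l// lecR ltW.
rewrite normf -!rmorphM/= ltcR mulrA gtr_pMl ?sqrtr_gt0//.
rewrite -[c0]ger0_norm ?ltW// -sqrtr_sqr -sqrtrM ?sqr_ge0// -[ltRHS]sqrtr1.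
rewrite ltr_sqrt// /k /eps.
have -> : c0 ^+ 2 * (2 * (2 * c0)^-1 ^+ 2 + 8 * C / L%:R) =
   2^-1 + 2^-1 * ((16 * C * c0 ^+ 2) / L%:R).
  by field; rewrite !gt_eqF.
have : (16 * C * c0 ^+ 2) / L%:R < 1 by rewrite ltr_pdivrMr ?mul1r.
lra.
Qed.

(** * Independent blocks *)
Section probability.
Context d (Omega : measurableType d) (R : realType) (P : probability Omega R).

Lemma ae_forall_countable (T : countType) (Q : T -> Omega -> Prop) :
  (forall t, {ae P, forall w, Q t w}) -> {ae P, forall w, forall t, Q t w}.
Proof.
move=> aeQ.
have : {ae P, forall w, forall n, if choice.unpickle n is Some t then Q t w else True}.
  apply: ae_foralln => n; case: (choice.unpickle n) => [t|]; first exact: aeQ.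
  exact: filterE.
by apply: filterS => w Qw t; have := Qw (choice.pickle t); rewrite choice.pickleK.
Qed.

Section repetitions.
Context (I : choiceType) (E : I -> set Omega) (p : R).
Context (mE : forall i, measurable (E i)).
Context (indepE : forall J : {fset I},
  P (\bigcap_(i in [set` J]) E i) = (p ^+ #|` J|)%:E).
Context (B : nat -> {fset I}) (L : nat).
Context (disjB : forall j k, j != k -> [disjoint B j & B k]%fset).
Context (cardB : forall k, #|` B k| = L).

Let on (J : {fset I}) := \bigcap_(i in [set` J]) E i.
Let missed K := \bigcap_(k in `I_K) ~` on (B k).

Let mon J : measurable (on J).
Proof. by apply: fin_bigcap_measurable => // *; exact: mE. Qed.

Let mmissed K : measurable (missed K).
Proof. by apply: fin_bigcap_measurable => // k _; exact/measurableC/mon. Qed.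

(** Independence is a product rule for intersections only.  The factor [on T], for
    an arbitrary [T] away from the first [K] blocks, lets the induction on [K]
    handle complements: to miss block [K] as well removes the event in which
    [T] is enlarged by that block. *)
Lemma probability_missed K (T : {fset I}) :
  (forall k, (k < K)%N -> [disjoint T & B k]%fset) ->
  P (missed K `&` on T) = ((1 - p ^+ L) ^+ K * p ^+ #|` T|)%:E.
Proof.
elim: K T => [|K IH] T disjT.
  rewrite /missed (_ : `I_0 = set0); last by apply/seteqP; split.
  by rewrite bigcap_set0 setTI indepE mul1r.
have -> : missed K.+1 `&` on T =
    (missed K `&` on T) `\` (missed K `&` on (T `|` B K)%fset).
  rewrite /missed IIS bigcap_setU bigcap_set1.
  have -> : on (T `|` B K)%fset = on T `&` on (B K).
    by rewrite /on set_fsetU bigcap_setU.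
  apply/seteqP; split => [w [[wK nB] wT]|w [[wK wT] nB]].
    by split=> // -[_ [_]].
  by split=> //; split=> // wB; apply: nB.
rewrite measureD; last 3 first.
- by apply: measurableI.
- by apply: measurableI.
- by rewrite ltey_eq fin_num_measure//; exact: measurableI.
rewrite setIACA setIid (_ : on T `&` on (T `|` B K)%fset = on (T `|` B K)%fset);
  last by rewrite /on set_fsetU bigcap_setU setIA setIid.
have cTB : #|` (T `|` B K)%fset| = (#|` T| + L)%N.
  by rewrite cardfsU (disjoint_fsetI0 (disjT K (ltnSn K))) cardfs0 subn0 cardB.
transitivity (((1 - p ^+ L) ^+ K * p ^+ #|` T|)%:E -
    ((1 - p ^+ L) ^+ K * p ^+ (#|` T| + L))%:E)%E; last first.
  by rewrite -EFinB; congr EFin; rewrite exprD exprSr; ring.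
congr (_ - _)%E; first by apply: IH => k kK; apply: disjT; rewrite ltnS ltnW.
rewrite -cTB; apply: IH => k kK.
by rewrite fdisjointUX disjT ?ltnS 1?ltnW//= disjB// gt_eqF.
Qed.

Lemma ae_hit : 0 < p -> {ae P, forall w, exists k, forall i, i \in B k -> E i w}.
Proof.
move=> p0.
have pL1 : p ^+ L <= 1.
  rewrite -lee_fin -(cardB 0) -indepE; exact: probability_le1 (mon _).
pose q := 1 - p ^+ L.
have q0 : 0 <= q by rewrite subr_ge0.
have q1 : `|q| < 1 by rewrite ger0_norm// gtrBl exprn_gt0.
pose N := \bigcap_k ~` on (B k).
have mN : measurable N.
  by apply: bigcap_measurable => // k _; exact/measurableC/mon.
have PN K : (P N <= (q ^+ K)%:E)%E.
  have := @probability_missed K fset0 (fun k _ => fdisjoint0X _).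
  rewrite cardfs0 mulr1 => <-; apply: le_measure; rewrite ?inE//.
    exact: measurableI.
  by move=> w Nw; split=> [k _|i]; [exact: Nw | rewrite /= inE].
exists N; split => //.
  apply/eqP; rewrite eq_le measure_ge0 andbT.
  have PNfin : P N \is a fin_num by exact: fin_num_measure.
  rewrite -(fineK PNfin) lee_fin.
  apply: (cvgr_to_ge (cvg_expr q1)); apply: nearW => K.
  by rewrite -lee_fin fineK.
move=> w /= nw k _ onk; apply: nw; exists k => i; exact: onk.
Qed.
End repetitions.
End probability.

(** * Almost sure properties of the potential *)
Definition rat_itv (R : realType) (ab : rat * rat) : set R :=
  `]ratr ab.1, ratr ab.2[.

Lemma open_rat_itv (R : realType) (U : set R) x : open U -> U x ->
  exists ab, rat_itv ab x /\ @rat_itv R ab `<=` U.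
Proof.
move=> oU Ux; have := open_nbhs_nbhs (conj oU Ux).
move=> /nbhs_ballP[e /= e0 xeU].
have [a] : exists q : rat, ratr q \in `]x - e, x[ by apply: rat_in_itvoo; lra.
have [b] : exists q : rat, ratr q \in `]x, x + e[ by apply: rat_in_itvoo; lra.
rewrite !in_itv/= => /andP[xb be] /andP[ea ax].
exists (a, b); rewrite /rat_itv/= in_itv/= ax xb; split=> // y.
rewrite /= in_itv/= => /andP[ay yb]; apply: xeU.
by rewrite -ball_normE/= ltr_norml; lra.
Qed.

Section iid.
Context (R : realType) (d : measure_display) (Omega : measurableType d)
  (P : probability Omega R) (mu : probability (measurableTypeR R) R)
  (V : int -> {RV P >-> measurableTypeR R}).
Context (indepV : mutually_independent V).
Context (lawV : forall (n : int) (A : set (measurableTypeR R)),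
  measurable A -> distribution P (V n) A = mu A).

Lemma measurable_rat_itv ab : measurable (@rat_itv R ab : set (measurableTypeR R)).
Proof. exact: measurable_itv. Qed.

Lemma ae_avoids_null_itv : {ae P, forall w, forall n ab,
  mu (rat_itv ab) = 0 -> ~ rat_itv ab (V n w)}.
Proof.
apply: ae_forall_countable => n; apply: ae_forall_countable => ab.
have [mu0|mu_neq0] := pselect (mu (rat_itv ab) = 0); last exact: filterE.
have mab := measurable_rat_itv ab.
exists (V n @^-1` rat_itv ab); split.
- exact: measurable_funPTI.
- by rewrite -mu0 -(lawV n mab).
- by move=> w /= /not_implyP[_ /contrapT].
Qed.

(** The successive blocks [[k * L, (k + 1) * L)] serve as independent trials. *)
Lemma ae_window ab L : (0 < mu (rat_itv ab))%E ->
  {ae P, forall w, exists N, forall n, n \in window N L -> rat_itv ab (V n w)}.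
Proof.
move=> mu0; have mab := measurable_rat_itv ab.
have mufin : mu (rat_itv ab) \is a fin_num by exact: fin_num_measure.
pose p := fine (mu (rat_itv ab)).
have : {ae P, forall w, exists k : nat, forall n,
    n \in window (k * L)%N%:Z L -> (V n @^-1` rat_itv ab) w}.
  apply: (@ae_hit _ _ _ _ _ (fun n => V n @^-1` rat_itv ab) p _ _
    (fun k => window (k * L)%N%:Z L) L).
  - by move=> n; exact: measurable_funPTI.
  - move=> J; rewrite (indepV J (A := fun=> rat_itv ab))//.
    rewrite (eq_bigr (fun=> p%:E)); last first.
      by move=> n _; rewrite fineK//; exact: lawV.
    by rewrite prodEFin big_const_seq count_predT iter_mulr_1.
  - move=> j k jk; apply/fdisjointP => n; rewrite !in_window; nia.
  - by move=> k; exact: card_window.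
  - by rewrite fine_gt0// mu0 ltey_eq mufin.
by apply: filterS => w [k wk]; exists (k * L)%N%:Z.
Qed.

(** A point outside the support lies in a rational interval of mass zero. *)
Lemma ae_in_support :
  {ae P, forall w, forall n, measure_support mu (V n w)}.
Proof.
apply: filterS ae_avoids_null_itv => w avoid n U oU UV.
rewrite lt0e measure_ge0 andbT; apply/eqP => U0.
have [ab [abV abU]] := open_rat_itv oU UV.
apply: (avoid n ab _ abV); apply/eqP; rewrite eq_le measure_ge0 andbT -U0.
rewrite le_measure ?inE//; first exact: measurable_rat_itv.
exact: measurable_realfun.open_measurable.
Qed.

Lemma ae_constant_windows : {ae P, forall w, forall m, measure_support mu m ->
  forall (eps : R) L, 0 < eps ->
  exists N, forall n, n \in window N L -> `|V n w - m| <= eps}.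
Proof.
have : {ae P, forall w, forall ab L, (0 < mu (rat_itv ab))%E ->
    exists N, forall n, n \in window N L -> rat_itv ab (V n w)}.
  apply: ae_forall_countable => ab; apply: ae_forall_countable => L.
  have [mu0|nmu0] := pselect ((0 < mu (rat_itv ab))%E); last exact: filterE.
  by apply: filterS (ae_window L mu0).
apply: filterS => w win m mm eps L eps0.
have oB : open (ball m eps) by exact: ball_open.
have [ab [abm abB]] := open_rat_itv oB (ballxx m eps0).
have [|N VN] := win ab L.
  by apply: mm abm; exact: interval_open.
exists N => n /VN /abB; rewrite -ball_normE/= distrC; exact: ltW.
Qed.

End iid.

(** * The ellipse *)
Lemma hn_ellipse_phase (R : realType) (g : R) z : hn_ellipse g z ->
  exists2 u, normc u = 1 & z = (expR g)%:C * u + (expR (- g))%:C * u^-1.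
Proof.
move=> [theta _ <-]; exists (cos theta +i* sin theta).
  by rewrite /normc cos2Dsin2 sqrtr1.
rewrite /cexp/= cosN sinN; congr (_ + _ * _).
(* the phase at [- theta] is the inverse of the phase [u] at [theta] *)
apply/esym/mulr1_eq/eqP; rewrite eq_complex/= mulrN opprK -!expr2 cos2Dsin2.
by apply/andP; split; [|apply/eqP; ring].
Qed.

(** * Spectrum of the random operator *)

Theorem theorem12 (R : realType) (d : measure_display)
  (Omega : measurableType d) (P : probability Omega R) (g : R)
  (mu : probability (measurableTypeR R) R)
  (V : int -> {RV P >-> measurableTypeR R}) :
  0 < g ->
  mutually_independent V ->
  (forall (n : int) (A : set (measurableTypeR R)), measurable A ->
     distribution P (V n) A = mu A) ->
  compact (measure_support mu) ->
  {ae P, forall omega : Omega,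
    exists H : {linear l2 R -> l2 R},
      [/\ bounded_operator H,
          (forall (f : l2 R) (n : int),
             H f n = hatano_nelson g (fun k => V k omega) f n) &
          forall m : R, measure_support mu m ->
            translate (hn_ellipse g) m%:C `<=` spectrum H]}.
Proof.
move=> _ indepV lawV suppC.
have [b b0 suppb] := pinfty_ex_gt0 (compact_bounded suppC).
apply: filterS2 (ae_in_support lawV) (ae_constant_windows indepV lawV).
move=> w wsupp win.
have [|H bH HE] := @hatano_nelson_bounded_operator R g (fun k => V k w) b.
  by move=> n; exact: suppb.
exists H; split=> // m mm _ [z /hn_ellipse_phase[u u1 ->] <-].
exact: spectrum_of_constant_windows HE u1 (win m mm).
Qed.
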